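(* Up to equivalence, every five-dimensional solvable subalgebra of $\mathfrak{sp}(4,\mathbb{C})$ is one of the following: $$\mathfrak{t}+\mathfrak{n}_{\mathfrak{p}},\qquad \langle\mathfrak{t},X_{\beta},X_{\alpha+\beta},X_{\alpha+2\beta}\rangle,\qquad \langle T,\mathfrak{n}\rangle,$$ where $T$ is one of the following: $T_{1,a}$ with $a\in\mathbb{C}$, $a\neq0,\pm1$; $T_{1,0}$; $T_{0,1}$; $T_{1,1}$; $T_{1,-1}$. Moreover, these algebras are pairwise nonisomorphic.
   Context: Let $J=\begin{pmatrix}0&0&1&0\\0&0&0&1\\-1&0&0&0\\0&-1&0&0\end{pmatrix}$. $\mathfrak{sp}(4,\mathbb{C})$ is the Lie algebra of $4\times4$ complex matrices $X$ with $JX^tJ=X$, and $Sp(4,\mathbb{C})=\{g\in GL(4,\mathbb{C}) : gJg^t=J\}$, acting on $\mathfrak{sp}(4,\mathbb{C})$ by conjugation $X\mapsto gXg^{-1}$. For $a,b\in\mathbb{C}$, $T_{a,b}=\mathrm{diag}(a,b,-a,-b)$, and $\mathfrak{t}=\{T_{a,b}: a,b\in\mathbb{C}\}$. With $E_{ij}$ the matrix units, $X_\alpha=E_{24}$, $X_\beta=E_{12}-E_{43}$, $X_{\alpha+\beta}=E_{14}+E_{23}$, $X_{\alpha+2\beta}=E_{13}$. $\langle\,\cdot\,\rangle$ denotes the complex linear span of the listed elements and subspaces. $\mathfrak{n}_{\mathfrak{p}}=\langle X_\alpha,X_{\alpha+\beta},X_{\alpha+2\beta}\rangle$ and $\mathfrak{n}=\langle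 X_\alpha,X_\beta,X_{\alpha+\beta},X_{\alpha+2\beta}\rangle$. Two subalgebras are equivalent if some $g\in Sp(4,\mathbb{C})$ conjugates one onto the other. *)

(* Defs.v *)
From HB Require Import structures.
From mathcomp Require Import all_boot all_order all_algebra.
From mathcomp Require Import reals.
From mathcomp Require Export complex.

Set Implicit Arguments.
Unset Strict Implicit.
Unset Printing Implicit Defensive.

Import GRing.Theory.
Local Open Scope ring_scope.

Section Lie.
Variable F : fieldType.
Implicit Types (X Y g : 'M[F]_4) (U V : {vspace 'M[F]_4}).

Definition bracket X Y : 'M[F]_4 := X *m Y - Y *m X.

(* Unlike [delta_mx], [E i j] numbers rows and columns from 1. *)
Definition E (i j : nat) : 'M[F]_4 := delta_mx (inord i.-1) (inord j.-1).

Definition J : 'M[F]_4 := E 1 3 + E 2 4 - E 3 1 - E 4 2.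

Definition sp4 : pred 'M[F]_4 := [pred X | J *m X^T *m J == X].

Definition Sp4 : pred 'M[F]_4 :=
  [pred g | (g \in unitmx) && (g *m J *m g^T == J)].

Definition sp4_subalgebra U : Prop :=
  {subset U <= sp4} /\ {in U &, forall X Y, bracket X Y \in U}.

(* [U, U]: by bilinearity the brackets of basis vectors span all brackets,
   see [derived_subP]. *)
Definition derived U : {vspace 'M[F]_4} :=
  <<[seq bracket X Y | X <- vbasis U, Y <- vbasis U]>>%VS.

Definition lie_solvable U : Prop := exists n, iter n derived U = 0%VS.

Definition conjugation g : 'End('M[F]_4) :=
  linfun (mulmx g \o mulmxr (invmx g)).

Definition Sp4_equivalent U V : Prop :=
  exists2 g, g \in Sp4 & (conjugation g @: U)%VS = V.

(* Every linear map from U to V extends to the ambient matrix space, so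
   ranging over endomorphisms of that space loses no isomorphism. *)
Definition lie_isomorphic U V : Prop :=
  exists f : 'End('M[F]_4),
    [/\ (f @: U)%VS = V,
        {in U &, injective f}
      & {in U &, forall X Y, f (bracket X Y) = bracket (f X) (f Y)}].

Definition T (a b : F) : 'M[F]_4 :=
  diag_mx (\row_i [:: a; b; - a; - b]`_i).

Definition X_a   : 'M[F]_4 := E 2 4.
Definition X_b   : 'M[F]_4 := E 1 2 - E 4 3.
Definition X_ab  : 'M[F]_4 := E 1 4 + E 2 3.
Definition X_a2b : 'M[F]_4 := E 1 3.

(* See [memtP]. *)
Definition t : {vspace 'M[F]_4} := <<[:: T 1 0; T 0 1]>>%VS.
Definition n_p : {vspace 'M[F]_4} := <<[:: X_a; X_ab; X_a2b]>>%VS.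
Definition n : {vspace 'M[F]_4} := <<[:: X_a; X_b; X_ab; X_a2b]>>%VS.

Variant label : Type :=
  | L_t_np
  | L_t_b
  | L_T1 of F
  | L_T10
  | L_T01
  | L_T11
  | L_T1m1.

Definition admissible (l : label) : Prop :=
  if l is L_T1 a then [/\ a <> 0, a <> 1 & a <> -1] else True.

Definition algebra_of (l : label) : {vspace 'M[F]_4} :=
  match l with
  | L_t_np => t + n_p
  | L_t_b => t + <<[:: X_b; X_ab; X_a2b]>>
  | L_T1 a => <[T 1 a]> + n
  | L_T10 => <[T 1 0]> + n
  | L_T01 => <[T 0 1]> + n
  | L_T11 => <[T 1 1]> + n
  | L_T1m1 => <[T 1 (- 1)]> + n
  end%VS.

Lemma derived_subP U V :
  reflect {in U &, forall X Y, bracket X Y \in V} (derived U <= V)%VS.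
Proof.
apply: (iffP span_subvP) => [sUV X Y XU YU | UV _ /allpairsP[[X Y] /= [XU YU ->]]].
  rewrite (coord_vbasis XU) (coord_vbasis YU) /bracket.
  rewrite mulmx_suml [X in _ - X]mulmx_sumr -sumrB.
  under eq_bigr do rewrite mulmx_sumr mulmx_suml -sumrB.
  rewrite memv_suml // => i _; rewrite memv_suml // => j _.
  rewrite -!scalemxAl -!scalemxAr !scalerA.
  rewrite [X in _ - X *: _]mulrC -scalerBr memvZ //; apply: sUV.
  by apply/allpairsP; exists ((vbasis U)`_i, (vbasis U)`_j);
     rewrite /= !mem_nth ?size_tuple.
by apply: UV; exact: vbasis_mem.
Qed.

Lemma memtP X : reflect (exists a b, X = T a b) (X \in t).
Proof.
have TE a b : T a b = a *: T 1 0 + b *: T 0 1.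
  apply/matrixP=> i j; rewrite !mxE.
  case: eqP => _; last by rewrite !mulr0n !mulr0 addr0.
  rewrite !mulr1n; case: i => [[|[|[|[|//]]]] ?] /=;
  by rewrite ?oppr0 ?mulrN ?mulr1 ?mulr0 ?addr0 ?add0r.
rewrite /t span_cons span_seq1; apply: (iffP memv_addP).
  by move=> [_ /vlineP[a ->] [_ /vlineP[b ->] ->]]; exists a, b.
move=> [a [b ->]]; exists (a *: T 1 0); first by rewrite memvZ ?memv_line.
by exists (b *: T 0 1); rewrite ?memvZ ?memv_line.
Qed.

End Lie.

(* Main.v *)
(* Lie's theorem, applied to the natural representation and then to the action
   on v^perp / v for a common eigenvector v, provides an isotropic flag stable
   under a solvable s; the flag is moved by Sp(4) to the one stabilised by the
   Borel subalgebra t + n, in which s then becomes a hyperplane.  Closure under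
   brackets leaves few hyperplanes: either s contains n, or the roots of s miss
   exactly one of the simple roots alpha, beta and conjugation by
   exp(k X_alpha) or exp(k X_beta) brings s to the standard form.
   For non-isomorphism, the ad-nilpotent elements of each algebra form its
   intersection with n.  If Y, W, X are such and V = [Y, W], Z = [X, V] <> 0,
   then every element T_(a,b) + (nilpotent) for which V and Z are eigenvectors
   acts on them with eigenvalues a + b and 2a, which recovers the line of T.
   For the two algebras containing t no such X, Y, W exist, and they differ by
   the commutativity of their ad-nilpotent elements. *)
Require Import Defs.
From mathcomp Require Import all_boot all_order all_algebra.
From mathcomp Require Import reals.
From mathcomp Require Import complex ring.

Set Implicit Arguments.
Unset Strict Implicit.
Unset Printing Implicit Defensive.
Import GRing.Theory Num.Theory.
Local Open Scope ring_scope.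

(** * Linear functionals, sums with a line, and the derived series of a subspace *)

Lemma separating_functional (F : fieldType) (vT : vectType F)
    (U : {vspace vT}) (v : vT) :
  v \notin U -> exists2 phi : 'Hom(vT, F^o), (U <= lker phi)%VS & phi v != 0.
Proof.
move=> vNU; pose b := vbasis (fullv : {vspace vT}).
(* [d] kills [U] but not [v], so some coordinate of [d v] is nonzero; that coordinate, composed with
   [d], is the functional. *)
pose d := (\1 - projv U)%VF.
have dE u : d u = u - projv U u by rewrite /d !lfun_simp.
have [i ci] : exists i, coord b i (d v) != 0.
  apply/existsP; apply: contraR vNU => /existsPn c0.
  have : d v = 0.
    rewrite (coord_vbasis (memvf (d v))) big1 // => i _.
    by move: (c0 i); rewrite negbK => /eqP ->; rewrite scale0r.
  by rewrite dE => /subr0_eq ->; exact: memv_proj.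
exists (linfun (coord b i : vT -> F^o) \o d)%VF; last by rewrite comp_lfunE lfunE.
apply/subvP=> u uU; rewrite memv_ker comp_lfunE dE projv_id // subrr.
by rewrite linear0.
Qed.

Lemma memv_lineD (F : fieldType) (vT : vectType F) (u v : vT) (U : {vspace vT}) :
  reflect (exists c, exists2 w, w \in U & u = c *: v + w) (u \in (<[v]> + U)%VS).
Proof.
apply: (iffP memv_addP) => [[_ /vlineP[c ->] [w wU ->]]|[c [w wU ->]]].
  by exists c, w.
by exists (c *: v); [exact: memvZ (memv_line v) | exists w].
Qed.

Lemma derived_mono (F : fieldType) (L K : {vspace 'M[F]_4}) :
  (K <= L)%VS -> (derived K <= derived L)%VS.
Proof.
move=> KL; apply/derived_subP => X Y XK YK.
by apply: (elimT (derived_subP L _) (subvv _)); apply: (subvP KL).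
Qed.

Lemma lie_solvableS (F : fieldType) (L K : {vspace 'M[F]_4}) :
  (K <= L)%VS -> lie_solvable L -> lie_solvable K.
Proof.
move=> KL [k Lk]; exists k; apply/eqP; rewrite -subv0 -Lk.
by elim: k {Lk} => //= k; exact: derived_mono.
Qed.

(** * Lie's theorem *)

Section LieTheorem.
Variable F : numClosedFieldType.
Implicit Types (L K : {vspace 'M[F]_4}).

Section Weight.
Variables (m : nat) (rho : {linear 'M[F]_4 -> 'M[F]_m.+1}).
Variables (K : {vspace 'M[F]_4}) (Z : 'M[F]_4).
Hypothesis normK : {in K, forall X, bracket Z X \in K}.
Hypothesis rhoZ : {in K, forall X,
  rho (bracket Z X) = rho Z *m rho X - rho X *m rho Z}.
Variables (lam : 'M[F]_4 -> F) (w : 'rV[F]_m.+1).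
Hypothesis w_neq0 : w != 0.
Hypothesis weight_w : {in K, forall X, w *m rho X = lam X *: w}.

Local Notation "w @ p" := (w *m horner_mx (rho Z) p) (at level 40).

(* Modulo lower Krylov terms, X acts on the vector w p(Z) as the scalar lam X,
   up to the correction w p'(Z) weighted by lam [Z, X]. *)
Lemma weight_expansion (p : {poly F}) X : X \in K ->
  exists2 r : {poly F}, (size r <= (size p).-2)%N &
    (w @ p) *m rho X = w @ (lam X *: p + lam (bracket Z X) *: p^`() + r).
Proof.
elim/poly_ind: p X => [|p c IH] X XK.
  by exists 0; rewrite ?size_poly0 // deriv0 !scaler0 !addr0 raddf0 mulmx0 mul0mx.
have [->|p0] := eqVneq p 0.
  exists 0; first by rewrite size_poly0.
  rewrite mul0r add0r derivC scaler0 !addr0 linearZ /= horner_mx_C.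
  by rewrite -scalemxAr mul_mx_scalar -scalemxAl weight_w // scalerA mulrC -scalerA.
have ZXK := normK XK.
have [r sr Er] := IH X XK; have [r' sr' Er'] := IH _ ZXK.
(* Since (pX + c)' = p + p'X, the first-bracket terms of both induction hypotheses combine into the
   derivative; the rest is the new remainder. *)
exists (r * 'X + lam (bracket Z (bracket Z X)) *: p^`() + r').
  rewrite size_MXaddC (negPf p0) /=.
  have sp : (0 < size p)%N by rewrite size_poly_gt0.
  have sd : (size p^`() <= (size p).-1)%N by rewrite -ltnS prednK ?lt_size_deriv.
  apply: leq_trans (size_polyD _ _) _; rewrite geq_max; apply/andP; split.
    apply: leq_trans (size_polyD _ _) _; rewrite geq_max; apply/andP; split.
      have [->|r0] := eqVneq r 0; first by rewrite mul0r size_poly0.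
      rewrite size_mulX //; move: sr r0; rewrite -size_poly_gt0.
      by case: (size p) => [|[|k]] //= ; case: (size r).
    exact: leq_trans (size_scale_leq _ _) sd.
  by apply: leq_trans sr' _; rewrite leq_pred.
have -> : (w @ (p * 'X + c%:P)) *m rho X =
    (w @ p *m rho X) *m rho Z + w @ p *m rho (bracket Z X) + (c * lam X) *: w.
  rewrite rhoZ // (raddfD (horner_mx (rho Z))) /= rmorphM /= horner_mx_X horner_mx_C.
  rewrite [in LHS]mulmxDr mulmxDl mul_mx_scalar -scalemxAl weight_w // scalerA.
  congr (_ + _); rewrite mulmxBr !mulmxA.
  by rewrite [RHS]addrC subrK.
rewrite Er Er' derivMXaddC.
have -> q : (w @ q) *m rho Z = w @ (q * 'X).
  by rewrite rmorphM /= horner_mx_X mulmxA.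
have -> : (c * lam X) *: w = w @ (c * lam X)%:P.
  by rewrite horner_mx_C mul_mx_scalar.
rewrite -!mulmxDr -!raddfD /=; congr (w @ _).
rewrite -!mul_polyC rmorphM /=; ring.
Qed.

(* Applied to a polynomial p of least degree annihilating w, the expansion has
   lam [Z, X] times the degree of p as its top coefficient. *)
Lemma weight_bracket0 X : X \in K -> lam (bracket Z X) = 0.
Proof.
move=> XK.
have: w @ (char_poly (rho Z)) = 0 by rewrite Cayley_Hamilton mulmx0.
have: char_poly (rho Z) != 0 by apply: monic_neq0; exact: char_poly_monic.
move: (char_poly _) => p; have [k] := ubnP (size p).
elim: k p => // k IH p; rewrite ltnS => sp p0 wp.
have [r sr] := weight_expansion p XK.
rewrite wp mul0mx -addrA raddfD mulmxDr /= linearZ /= -scalemxAr wp scaler0 add0r.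
set q := (X in w @ X) => /esym wq.
have [q0|q0] := eqVneq q 0; last first.
  apply: IH q0 wq; apply: leq_trans sp.
  have sp0 : (0 < size p)%N by rewrite size_poly_gt0.
  rewrite -[in X in (_ < X)%N](prednK sp0) ltnS.
  apply: leq_trans (size_polyD _ _) _; rewrite geq_max; apply/andP; split.
    apply: leq_trans (size_scale_leq _ _) _.
    by rewrite -ltnS prednK // lt_size_deriv.
  by apply: leq_trans sr (leq_pred _).
have [s1|s1] := leqP (size p) 1.
  case/eqP: w_neq0; move: wp p0; rewrite (size1_polyC s1) horner_mx_C.
  rewrite mul_mx_scalar polyC_eq0 => /eqP.
  by rewrite scaler_eq0 => /orP[/eqP ->|/eqP//]; rewrite eqxx.
(* [r] is too short to reach this index, and the degree of [p] is a nonzero scalar in characteristic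
   zero. *)
have := congr1 (fun q : {poly F} => q`_(size p).-2) q0.
rewrite coefD coefZ coef_deriv coef0 [r`__]nth_default //.
have -> : (size p).-2.+1 = (size p).-1 by case: (size p) s1 => [|[]].
rewrite addr0 -/(lead_coef p) => /eqP.
rewrite mulf_eq0 mulrn_eq0 lead_coef_eq0 (negPf p0) orbF.
by case/orP=> /eqP // s0; move: s1; case: (size p) s0 => [|[]].
Qed.

(** As [lam] vanishes on brackets with [Z], the actions of [Z] and [X] commute on [w]. This allows
    linear factors in [Z] to be applied without leaving the weight space. *)
Lemma weight_shift c :
  {in K, forall X, (w *m (rho Z - c%:M)) *m rho X = lam X *: (w *m (rho Z - c%:M))}.
Proof.
move=> X XK; rewrite mulmxBr mulmxBl mul_mx_scalar -scalemxAl (weight_w XK).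
have -> : w *m rho Z *m rho X = w *m rho X *m rho Z.
  apply/eqP; rewrite -subr_eq0 -!mulmxA -mulmxBr -(rhoZ XK) (weight_w (normK XK)).
  by rewrite weight_bracket0 // scale0r.
by rewrite (weight_w XK) scalerBr -scalemxAl scalerA mulrC -scalerA.
Qed.

End Weight.

(** Induction on the dimension: a common eigenvector of an ideal of codimension one is improved to
    one for all of [L]. Matrices act on row vectors from the right. *)
Theorem lie_common_eigenvector m (rho : {linear 'M[F]_4 -> 'M[F]_m.+1}) L :
    {in L &, forall X Y, bracket X Y \in L} -> lie_solvable L ->
    {in L &, forall X Y,
      rho (bracket X Y) = rho X *m rho Y - rho Y *m rho X} ->
  exists2 v : 'rV[F]_m.+1, v != 0 &
    {in L, forall X, exists c, v *m rho X = c *: v}.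
Proof.
have [k] := ubnP (\dim L); elim: k L => // k IH L; rewrite ltnS => dL Lb Ls Lr.
have [L0|L0] := eqVneq L 0%VS.
  exists (const_mx 1); last first.
    by move=> X; rewrite L0 memv0 => /eqP ->; exists 0; rewrite raddf0 mulmx0 scale0r.
  by apply/eqP => /matrixP /(_ 0 0) /eqP; rewrite !mxE oner_eq0.
(* Otherwise the derived series would be constant at [L] and never reach zero. *)
have [Z ZL ZD] : exists2 Z, Z \in L & Z \notin derived L.
  apply/subvPn; apply: contraNN L0 => LD.
  have DL : derived L = L.
    by apply/eqP; rewrite eqEsubv LD andbT; apply/derived_subP.
  have [j Lj] := Ls; suff <- : iter j (@derived F) L = L by rewrite Lj.
  by elim: j {Lj} => //= j ->.
have [phi Dphi phiZ] := separating_functional ZD.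
(* [phi] vanishes on the derived algebra and not at [Z], so [K] is an ideal and [L] is [K] plus the
   line of [Z]. *)
pose K := (L :&: lker phi)%VS.
have KL : (K <= L)%VS by exact: capvSl.
have bK X Y : X \in L -> Y \in L -> bracket X Y \in K.
  move=> XL YL; rewrite memv_cap Lb //=; apply: (subvP Dphi).
  exact: (elimT (derived_subP L _) (subvv _)).
have inL X : X \in K -> X \in L by exact: (subvP KL).
have [] := IH K.
- apply: leq_trans dL; rewrite ltnNge; apply: contra phiZ => dLK.
  have /eqP KE : K == L by rewrite eqEdim KL.
  by move: ZL; rewrite -KE memv_cap memv_ker => /andP[].
- by move=> X Y XK YK; apply: bK; apply: inL.
- exact: lie_solvableS Ls.
- by move=> X Y XK YK; apply: Lr; apply: inL.
move=> w0 w0N0 w0K.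
have [j w0j] : exists j, w0 0 j != 0.
  by apply/rV0Pn.
(* Reading off a nonzero coordinate turns the pointwise eigenvalues into a function of [X]. *)
pose lam X := (w0 *m rho X) 0 j / w0 0 j.
have w0lam : {in K, forall X, w0 *m rho X = lam X *: w0}.
  move=> X XK; have [c Ec] := w0K X XK.
  by rewrite /lam Ec mxE mulfK.
have Znorm : {in K, forall X, bracket Z X \in K} by move=> X XK; apply: bK => //; exact: inL.
have Zr : {in K, forall X, rho (bracket Z X) = rho Z *m rho X - rho X *m rho Z}.
  by move=> X XK; apply: Lr => //; exact: inL.
(* The characteristic polynomial splits and annihilates [w0]. Applying its factors one at a time,
   the last nonzero vector is an eigenvector of [Z] and still a weight vector of [K]. *)
have [r] := closed_field_poly_normal (char_poly (rho Z)).
have := char_poly_monic (rho Z); rewrite monicE => /eqP ->; rewrite scale1r => rE.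
have : w0 *m horner_mx (rho Z) (\prod_(z <- r) ('X - z%:P)) = 0.
  by rewrite -rE Cayley_Hamilton mulmx0.
elim: r {rE w0j} (w0) w0N0 {w0K} (lam) w0lam => [|c r IHr] w w_neq0 {}lam wlam.
  by rewrite big_nil rmorph1 mulmx1 => /eqP; rewrite (negPf w_neq0).
rewrite big_cons rmorphM /= mulmxA raddfB /= horner_mx_X horner_mx_C.
have [wc0 _|wc0] := eqVneq (w *m (rho Z - c%:M)) 0; last first.
  by apply: (IHr _ wc0 lam); exact: weight_shift.
exists w => // X XL; pose a : F := phi X / phi Z.
exists (lam (X - a *: Z) + a * c).
have XK : X - a *: Z \in K.
  rewrite memv_cap memvB ?memvZ //= memv_ker linearB linearZ /=.
  by rewrite /a [_ *: _]divfK // subrr.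
have rhoD : rho X = rho (X - a *: Z) + a *: rho Z.
  rewrite -[in LHS](subrK (a *: Z) X) raddfD; congr (_ + _). exact: linearZ.
rewrite rhoD mulmxDr (wlam _ XK) -scalemxAr.
move/eqP: wc0; rewrite mulmxBr mul_mx_scalar subr_eq0 => /eqP ->.
by rewrite scalerA scalerDl.
Qed.

End LieTheorem.

(** * Explicit 4x4 matrices and the Borel subalgebra *)

Section Entries.
Variable F : fieldType.
Implicit Types X : 'M[F]_4.

(* [s] lists the sixteen entries row by row. *)
Definition mx4 (s : seq F) : 'M[F]_4 := \matrix_(i, j) s`_(4 * i + j).

Local Ltac entries := let i := fresh in let j := fresh in
  apply/matrixP => i j;
  case: i => [[|[|[|[|//]]]] ?]; case: j => [[|[|[|[|//]]]] ?];
  rewrite !mxE ?big_ord_recl ?big_ord0 ?mxE /=.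

Lemma mx4_eta X : X = mx4 [seq X (inord (k %/ 4)) (inord (k %% 4)) | k <- iota 0 16].
Proof.
by entries; congr (X _ _); apply: val_inj; rewrite /= inordK.
Qed.

(** The sizes matter: missing entries are read as zero and entries past the sixteenth are
    ignored. *)
Lemma mx4_inj s t : mx4 s = mx4 t -> size s = 16%N -> size t = 16%N -> s = t.
Proof.
move=> /matrixP e ss st; apply: (@eq_from_nth _ 0) => [|k]; first by rewrite st.
rewrite ss => k16; have := e (inord (k %/ 4)) (inord (k %% 4)).
rewrite !mxE !inordK ?ltn_mod // ?ltn_divLR //.
by rewrite [(4 * _)%N]mulnC -divn_eq.
Qed.

(** Entries are written out so that rewriting yields a literal list again, and matrix identities
    become sixteen scalar ones. *)
Lemma mx4D a11 a12 a13 a14 a21 a22 a23 a24 a31 a32 a33 a34 a41 a42 a43 a44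
    b11 b12 b13 b14 b21 b22 b23 b24 b31 b32 b33 b34 b41 b42 b43 b44 :
  mx4 [:: a11; a12; a13; a14; a21; a22; a23; a24; a31; a32; a33; a34; a41; a42; a43; a44]
  + mx4 [:: b11; b12; b13; b14; b21; b22; b23; b24; b31; b32; b33; b34; b41; b42; b43; b44]
  = mx4 [:: a11 + b11; a12 + b12; a13 + b13; a14 + b14; a21 + b21; a22 + b22; a23 + b23; a24 + b24;
           a31 + b31; a32 + b32; a33 + b33; a34 + b34; a41 + b41; a42 + b42; a43 + b43; a44 + b44].
Proof. by entries. Qed.

Lemma mx4N s : - mx4 s = mx4 [seq - x | x <- s].
Proof.
apply/matrixP => i j; rewrite !mxE.
have [h|h] := ltnP (4 * i + j) (size s); first by rewrite (nth_map 0).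
by rewrite !nth_default ?size_map // oppr0.
Qed.

Lemma mx4Z c s : c *: mx4 s = mx4 [seq c * x | x <- s].
Proof.
apply/matrixP => i j; rewrite !mxE.
have [h|h] := ltnP (4 * i + j) (size s); first by rewrite (nth_map 0).
by rewrite !nth_default ?size_map // mulr0.
Qed.

Lemma mx4M a11 a12 a13 a14 a21 a22 a23 a24 a31 a32 a33 a34 a41 a42 a43 a44
    b11 b12 b13 b14 b21 b22 b23 b24 b31 b32 b33 b34 b41 b42 b43 b44 :
  mx4 [:: a11; a12; a13; a14; a21; a22; a23; a24; a31; a32; a33; a34; a41; a42; a43; a44]
  *m mx4 [:: b11; b12; b13; b14; b21; b22; b23; b24; b31; b32; b33; b34; b41; b42; b43; b44]
  = mx4 [:: a11 * b11 + a12 * b21 + a13 * b31 + a14 * b41;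
            a11 * b12 + a12 * b22 + a13 * b32 + a14 * b42;
            a11 * b13 + a12 * b23 + a13 * b33 + a14 * b43;
            a11 * b14 + a12 * b24 + a13 * b34 + a14 * b44;
            a21 * b11 + a22 * b21 + a23 * b31 + a24 * b41;
            a21 * b12 + a22 * b22 + a23 * b32 + a24 * b42;
            a21 * b13 + a22 * b23 + a23 * b33 + a24 * b43;
            a21 * b14 + a22 * b24 + a23 * b34 + a24 * b44;
            a31 * b11 + a32 * b21 + a33 * b31 + a34 * b41;
            a31 * b12 + a32 * b22 + a33 * b32 + a34 * b42;
            a31 * b13 + a32 * b23 + a33 * b33 + a34 * b43;
            a31 * b14 + a32 * b24 + a33 * b34 + a34 * b44;
            a41 * b11 + a42 * b21 + a43 * b31 + a44 * b41;
            a41 * b12 + a42 * b22 + a43 * b32 + a44 * b42;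
            a41 * b13 + a42 * b23 + a43 * b33 + a44 * b43;
            a41 * b14 + a42 * b24 + a43 * b34 + a44 * b44].
Proof. by entries; rewrite addr0 !addrA. Qed.

Lemma mx4T a11 a12 a13 a14 a21 a22 a23 a24 a31 a32 a33 a34 a41 a42 a43 a44 :
  (mx4 [:: a11; a12; a13; a14; a21; a22; a23; a24; a31; a32; a33; a34; a41; a42; a43; a44])^T
  = mx4 [:: a11; a21; a31; a41; a12; a22; a32; a42; a13; a23; a33; a43; a14; a24; a34; a44].
Proof. by entries. Qed.

Lemma mx4_1 : 1%:M = mx4 [:: 1; 0; 0; 0; 0; 1; 0; 0; 0; 0; 1; 0; 0; 0; 0; 1].
Proof. by entries. Qed.

Lemma E_mx4 i j : (0 < i <= 4)%N -> (0 < j <= 4)%N ->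
  E F i j = mx4 [seq ((k %/ 4 == i.-1) && (k %% 4 == j.-1))%N%:R | k <- iota 0 16].
Proof.
move=> i4 j4; apply/matrixP => k l; rewrite !mxE (nth_map 0%N); last first.
  rewrite size_iota; case: k l => [k k4] [l l4] /=.
  by case: k k4 => [|[|[|[|]]]]; case: l l4 => [|[|[|[|]]]].
rewrite nth_iota; last first.
  case: k l => [k k4] [l l4] /=.
  by case: k k4 => [|[|[|[|]]]]; case: l l4 => [|[|[|[|]]]].
rewrite add0n [(4 * _)%N]mulnC divnMDl // modnMDl.
rewrite (divn_small (ltn_ord l)) (modn_small (ltn_ord l)) addn0.
by rewrite -!val_eqE /= !inordK // ; [case: j j4 => [|[|[|[|[|]]]]]
                                  | case: i i4 => [|[|[|[|[|]]]]]].
Qed.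


End Entries.

Local Ltac mx4_by tac :=
  congr mx4; do 16?[apply: (f_equal2 cons); first by tac]; done.

Local Ltac mx4_ring := mx4_by ltac:(ring).

(** * The symplectic group and its Lie algebra in coordinates *)

Section Symplectic.
Variable F : fieldType.
Implicit Types (X Y g : 'M[F]_4).
Local Notation J := (@J F).
Local Notation Sp4 := (@Sp4 F).
Local Notation sp4 := (@sp4 F).


Lemma J_mx4 : J = mx4 [:: 0; 0; 1; 0; 0; 0; 0; 1; -1; 0; 0; 0; 0; -1; 0; 0].
Proof. by rewrite /Defs.J !E_mx4 //= !mx4N /= !mx4D; mx4_ring. Qed.

(* The element T_(a,b) + x X_alpha + y X_beta + z X_(alpha+beta) + w X_(alpha+2beta). *)
Definition bor a b x y z w : 'M[F]_4 :=
  mx4 [:: a; y; w; z; 0; b; z; x; 0; 0; - a; 0; 0; 0; - y; - b].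

Lemma bor_basis a b x y z w :
  bor a b x y z w = T a b + (x *: X_a F + y *: X_b F + z *: X_ab F + w *: X_a2b F).
Proof.
rewrite /X_a /X_b /X_ab /X_a2b !E_mx4 //= !mx4N /= !mx4D !mx4Z /= !mx4D.
rewrite (mx4_eta (T a b)) /= !mxE -!val_eqE /= !inordK //= !mulr1n !mulr0n mx4D.
by mx4_ring.
Qed.

Lemma borD a b x y z w a' b' x' y' z' w' :
  bor a b x y z w + bor a' b' x' y' z' w' =
  bor (a + a') (b + b') (x + x') (y + y') (z + z') (w + w').
Proof. by rewrite mx4D; mx4_ring. Qed.

Lemma borZ c a b x y z w :
  c *: bor a b x y z w = bor (c * a) (c * b) (c * x) (c * y) (c * z) (c * w).
Proof. by rewrite mx4Z /=; mx4_ring. Qed.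

Lemma T_bor (a b : F) : T a b = bor a b 0 0 0 0 :> 'M[F]_4.
Proof. by rewrite bor_basis !scale0r !addr0. Qed.

Lemma bor0 : bor 0 0 0 0 0 0 = 0 :> 'M[F]_4.
Proof. by rewrite -[RHS](scale0r (bor 0 0 0 0 0 0)) borZ mul0r. Qed.

Lemma bor_inj a b x y z w a' b' x' y' z' w' :
  bor a b x y z w = bor a' b' x' y' z' w' ->
  [/\ a = a', b = b' & [/\ x = x', y = y', z = z' & w = w']].
Proof. by move/mx4_inj/(_ erefl erefl) => [-> -> -> -> -> _ -> *]. Qed.

(** On T_(a,b) the roots alpha, beta, alpha+beta, alpha+2beta take the values 2b, a - b, a + b, 2a.
    The other terms come from [X_beta, X_alpha] = X_(alpha+beta) and [X_beta, X_(alpha+beta)] = 2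
    X_(alpha+2beta). *)
Lemma bracket_bor a b x y z w a' b' x' y' z' w' :
  bracket (bor a b x y z w) (bor a' b' x' y' z' w') =
  bor 0 0 ((b * x' - b' * x) *+ 2) ((a - b) * y' - (a' - b') * y)
    ((a + b) * z' - (a' + b') * z + (y * x' - y' * x))
    ((a * w' - a' * w + (y * z' - y' * z)) *+ 2).
Proof. by rewrite /bracket !mx4M mx4N /= mx4D; mx4_ring. Qed.

Lemma bor_sp4 a b x y z w : bor a b x y z w \in sp4.
Proof. by rewrite inE J_mx4 mx4T !mx4M; apply/eqP; mx4_ring. Qed.


Lemma mx4_entries X : exists a11 a12 a13 a14 a21 a22 a23 a24 a31 a32 a33 a34 a41 a42 a43 a44,
  X = mx4 [:: a11; a12; a13; a14; a21; a22; a23; a24; a31; a32; a33; a34; a41; a42; a43; a44].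
Proof. by rewrite (mx4_eta X) /=; do 16?eexists. Qed.

(** The usual 2x2 block form: A and -A^t on the diagonal, symmetric blocks off it. *)
Lemma sp4P X : X \in sp4 -> exists a11 a12 a21 a22 b11 b12 b22 c11 c12 c22,
  X = mx4 [:: a11; a12; b11; b12; a21; a22; b12; b22;
              c11; c12; - a11; - a21; c12; c22; - a12; - a22].
Proof.
have [a [b [c [d [e [f [g [h [i [j [k [l [m [n [o [p ->]]]]]]]]]]]]]]]] := mx4_entries X.
have JXJ : J *m (mx4 [:: a; b; c; d; e; f; g; h; i; j; k; l; m; n; o; p])^T *m J =
    mx4 [:: - k; - o; c; g; - l; - p; d; h; i; m; - a; - e; j; n; - b; - f].
  by rewrite mx4T J_mx4 !mx4M; mx4_ring.
rewrite inE JXJ => /eqP/mx4_inj/(_ erefl erefl)[] _ _ gd _ _ _ _ mj ka le ob pf.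
exists a, b, e, f, c, d, h, i, j, n.
by rewrite gd mj ka le ob pf.
Qed.

Lemma mulmxJJ : J *m J = - 1%:M.
Proof. by rewrite J_mx4 mx4_1 mx4N mx4M /=; mx4_ring. Qed.

(** Since J^2 = -1, the relation exhibits J g^t (-J) as a right inverse of [g]. *)
Lemma Sp4P g : reflect (g *m J *m g^T = J) (g \in Sp4).
Proof.
rewrite inE; apply: (iffP andP) => [[_ /eqP]//|gJ]; split; last exact/eqP.
have: g *m (J *m g^T *m (- J)) = 1%:M.
  by rewrite !mulmxA gJ mulmxN mulmxJJ opprK.
by case/mulmx1_unit.
Qed.

Lemma Sp4_unit g : g \in Sp4 -> g \in unitmx.
Proof. by case/andP. Qed.

Lemma Sp4M g h : g \in Sp4 -> h \in Sp4 -> g *m h \in Sp4.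
Proof.
move=> /Sp4P gJ /Sp4P hJ; apply/Sp4P.
by rewrite trmx_mul !mulmxA -(mulmxA g h) -(mulmxA g (h *m J)) hJ.
Qed.

Lemma conjugationE g X : conjugation g X = g *m X *m invmx g.
Proof. by rewrite lfunE /= mulmxA. Qed.

Lemma conjugationM g h X : g \in unitmx -> h \in unitmx ->
  conjugation (g *m h) X = conjugation g (conjugation h X).
Proof.
move=> gu hu; rewrite !conjugationE.
have -> : invmx (g *m h) = invmx h *m invmx g by exact: (invrM gu hu).
by rewrite !mulmxA.
Qed.

Lemma conjugation_bracket g X Y : g \in unitmx ->
  conjugation g (bracket X Y) = bracket (conjugation g X) (conjugation g Y).
Proof.
move=> gu; rewrite /bracket linearB /= !conjugationE.
by rewrite !mulmxA !(mulmxKV gu).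
Qed.

Lemma dim_conjugation g U : g \in unitmx -> \dim (conjugation g @: U) = \dim U.
Proof.
move=> gu; apply: limg_dim_eq; apply/eqP; rewrite -subv0; apply/subvP=> X.
rewrite memv_cap memv_ker conjugationE => /andP[_ /eqP gX].
by rewrite memv0 -(mulKmx gu X) -[g *m X](mulmxKV gu) gX mul0mx mulmx0.
Qed.

(** From J (g^-1)^t = g J and g^t J = J g^-1, conjugation by [g] commutes with the map sending X to
    J X^t J. *)
Lemma conjugation_sp4 g X : g \in Sp4 -> X \in sp4 -> conjugation g X \in sp4.
Proof.
move=> gS; have gu := Sp4_unit gS; move: gS => /Sp4P gJ.
rewrite !inE conjugationE => /eqP XE.
have JgV : J *m (invmx g)^T = g *m J.
  by rewrite -{1}gJ -mulmxA -trmx_mul mulVmx // trmx1 mulmx1.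
have gTJ : g^T *m J = J *m invmx g.
  have gJu : g *m J \in unitmx.
    have: J *m (- J) = 1%:M by rewrite mulmxN mulmxJJ opprK.
    by case/mulmx1_unit => Ju _; rewrite unitmx_mul gu.
  apply: (can_inj (mulKmx gJu)); rewrite !mulmxA gJ mulmxJJ.
  by rewrite -(mulmxA g) mulmxJJ mulmxN mulmx1 mulNmx mulmxV.
by rewrite -{2}XE !trmx_mul !mulmxA JgV -(mulmxA _ g^T) gTJ !mulmxA.
Qed.

(** Transitivity of Sp(4) on nonzero vectors. The third basis row vector is the target because it is
    an eigenvector of every matrix [bor]. *)
Lemma conj_to_row3 (v : 'rV[F]_4) : v != 0 ->
  exists2 g, g \in Sp4 & row (inord 2) g = v.
Proof.
have base (u : 'rV[F]_4) : u 0 (inord 2) != 0 -> exists2 g, g \in Sp4 & row (inord 2) g = u.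
  move=> u2; set a := u 0 (inord 0); set b := u 0 (inord 1).
  set c := u 0 (inord 2) in u2 *; set d := u 0 (inord 3).
  exists (mx4 [:: c^-1; 0; 0; 0; - d / c; 1; 0; 0; a; b; c; d; b / c; 0; 0; 1]).
    apply/Sp4P; rewrite J_mx4 mx4T !mx4M; mx4_by ltac:(field).
  apply/rowP => j; rewrite !mxE inordK //.
  rewrite -[in RHS](inord_val j).
  by case: j => [[|[|[|[|//]]]] ?].
have move_by w w' : w' \in Sp4 -> w *m w' = 1%:M -> (v *m w) 0 (inord 2) != 0 ->
    exists2 g, g \in Sp4 & row (inord 2) g = v.
  move=> wS ww' /base[g gS gv]; exists (g *m w'); first exact: Sp4M.
  by rewrite row_mul gv -mulmxA ww' mulmx1.
(* [P] swaps coordinates 1 with 2 and 3 with 4, while [J] exchanges the two halves up to sign;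
   together they bring any nonzero coordinate to third place. *)
pose P : 'M[F]_4 := mx4 [:: 0; 1; 0; 0; 1; 0; 0; 0; 0; 0; 0; 1; 0; 0; 1; 0].
have PS : P \in Sp4 by apply/Sp4P; rewrite J_mx4 mx4T !mx4M; mx4_ring.
have PP : P *m P = 1%:M by rewrite mx4M mx4_1; mx4_ring.
have NJS : - J \in Sp4 by apply/Sp4P; rewrite J_mx4 mx4N /= mx4T !mx4M; mx4_ring.
have JNJ : J *m (- J) = 1%:M by rewrite mulmxN mulmxJJ opprK.
have vmulE s : (v *m mx4 s) 0 (inord 2) = v 0 (inord 0) * s`_2 + v 0 (inord 1) * s`_6
    + v 0 (inord 2) * s`_10 + v 0 (inord 3) * s`_14.
  rewrite !mxE !big_ord_recl big_ord0 !mxE /= inordK // addr0 !addrA.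
  by do !congr (_ + _); congr (v _ _ * _); apply: val_inj; rewrite /= ?inordK.
case/rV0Pn => j; rewrite -(inord_val j); case: j => [[|[|[|[|//]]]] ?] /= vj.
- apply: (move_by J (- J)) => //.
  by rewrite J_mx4 vmulE /= !mulr0 mulr1 !addr0.
- apply: (move_by (P *m J) (- J *m P)); first exact: Sp4M.
    by rewrite mulmxA -(mulmxA P) JNJ mulmx1.
  by rewrite J_mx4 mx4M vmulE /= !(mulr0, mul0r, mulr1, mul1r, addr0, add0r).
- exact: base.
- by apply: (move_by P P); rewrite // vmulE /= !mulr0 mulr1 !add0r.
Qed.

Lemma mem_nP X : reflect (exists x y z w, X = bor 0 0 x y z w) (X \in n F).
Proof.
rewrite /n 3!span_cons span_seq1.
have E x y z w : bor 0 0 x y z w =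
    x *: X_a F + (y *: X_b F + (z *: X_ab F + w *: X_a2b F)).
  by rewrite bor_basis T_bor bor0 add0r !addrA.
apply: (iffP idP) => [/memv_lineD[x [_ /memv_lineD[y [_ /memv_lineD[z [_ /vlineP[w ->] ->]] ->]] ->]]|].
  by exists x, y, z, w.
move=> [x [y [z [w ->]]]]; rewrite E.
apply/memv_lineD; exists x; eexists; last by [].
apply/memv_lineD; exists y; eexists; last by [].
apply/memv_lineD; exists z; eexists; last by [].
exact: memvZ (memv_line _).
Qed.

Definition borel : {vspace 'M[F]_4} := (t F + n F)%VS.

Lemma mem_borelP X : reflect (exists a b x y z w, X = bor a b x y z w) (X \in borel).
Proof.
have E a b x y z w : bor a b x y z w = T a b + bor 0 0 x y z w.
  by rewrite T_bor borD !(addr0, add0r).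
apply: (iffP memv_addP) => [[_ /memtP[a [b ->]] [_ /mem_nP[x [y [z [w ->]]]] ->]]|].
  by exists a, b, x, y, z, w.
move=> [a [b [x [y [z [w ->]]]]]]; exists (T a b); first by apply/memtP; exists a, b.
by exists (bor 0 0 x y z w) => //; apply/mem_nP; exists x, y, z, w.
Qed.

End Symplectic.

(** * Triangularisation *)

Section Triangular.
Variable F : numClosedFieldType.
Local Notation Sp4 := (@Sp4 F).
Local Notation sp4 := (@sp4 F).

Lemma solvable_conj_borel (s : {vspace 'M[F]_4}) :
    sp4_subalgebra s -> lie_solvable s ->
  exists2 g, g \in Sp4 & (conjugation g @: s <= borel F)%VS.
Proof.
move=> [s_sp4 s_br] s_sol.
have [|v v0 sv] := @lie_common_eigenvector F 3 idfun s s_br s_sol; first by [].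
have [g gS gv] := conj_to_row3 v0; have gu := Sp4_unit gS.
(* The parabolic subalgebra stabilising the line of the third basis row vector. *)
pose par a11 a12 a22 b11 b12 b22 c22 : 'M[F]_4 := mx4 [:: a11; a12; b11; b12; 0; a22; b12; b22;
              0; 0; - a11; 0; 0; c22; - a12; - a22].
have gP : {in s, forall X, exists a11 a12 a22 b11 b12 b22 c22,
    conjugation g X = par a11 a12 a22 b11 b12 b22 c22}.
  move=> X Xs; have [a11 [a12 [a21 [a22 [b11 [b12 [b22 [c11 [c12 [c22 E]]]]]]]]]] :=
    sp4P (conjugation_sp4 gS (s_sp4 X Xs)).
  have [c vX] := sv X Xs.
  have row_gX j : (conjugation g X) (inord 2) j = (c *: row (inord 2) 1%:M) 0 j.
    transitivity ((row (inord 2) (conjugation g X)) 0 j); first by rewrite mxE.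
    by rewrite conjugationE !row_mul gv vX -scalemxAl -gv -row_mul mulmxV.
  move: (row_gX (inord 0)) (row_gX (inord 1)) (row_gX (inord 3)).
  rewrite E !mxE -!val_eqE /= !inordK //= !mulr0.
  move=> c110 c120 /eqP; rewrite oppr_eq0 => /eqP a210.
  by exists a11, a12, a22, b11, b12, b22, c22; rewrite c110 c120 a210 oppr0.
(* Rows and columns 2 and 4 carry the action on v^perp / v. *)
pose f (i : 'I_2) : 'I_4 := inord (i.*2.+1).
pose rho : {linear 'M[F]_4 -> 'M[F]_2} := (mxsub f f \o conjugation g)%FUN.
have rho_par a11 a12 a22 b11 b12 b22 c22 : mxsub f f (par a11 a12 a22 b11 b12 b22 c22) =
    \matrix_(i, j) [:: a22; b22; c22; - a22]`_(2 * i + j).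
  apply/matrixP => i j; rewrite !mxE !inordK /=;
  by case: i => [[|[|//]] ?]; case: j => [[|[|//]] ?].
have rho_br : {in s &, forall X Y,
    rho (bracket X Y) = rho X *m rho Y - rho Y *m rho X}.
  move=> X Y Xs Ys; rewrite /= conjugation_bracket //.
  have [a [b [c [d [e [h [i ->]]]]]]] := gP X Xs.
  have [a' [b' [c' [d' [e' [h' [i' ->]]]]]]] := gP Y Ys.
  rewrite !rho_par /bracket !mx4M mx4N mx4D.
  apply/matrixP => k l; rewrite !mxE !big_ord_recl !big_ord0 !mxE !inordK /=;
  case: k => [[|[|//]] ?]; case: l => [[|[|//]] ?] //=; ring.
have [u u0 su] := lie_common_eigenvector s_br s_sol rho_br.
set p := u 0 (inord 0); set q := u 0 (inord 1).
(* The eigenvector (p, q) becomes the second row of a 2x2 matrix of determinant one, which [h]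
   embeds in Sp(4) through rows and columns 2 and 4. *)
have [r [t rtpq]] : exists r t, r * q - t * p = 1.
  have [q0|q0] := eqVneq q 0; last by exists q^-1, 0; rewrite mulVf // mul0r subr0.
  have [p0|p0] := eqVneq p 0; last by exists 0, (- p^-1); rewrite mul0r mulNr mulVf // opprK add0r.
  case/rV0Pn: u0 => j; rewrite -(inord_val j).
  by case: j => [[|[|//]] ?] /=; rewrite -/p -/q ?p0 ?q0 eqxx.
pose h : 'M[F]_4 := mx4 [:: 1; 0; 0; 0; 0; r; 0; t; 0; 0; 1; 0; 0; p; 0; q].
pose hV : 'M[F]_4 := mx4 [:: 1; 0; 0; 0; 0; q; 0; - t; 0; 0; 1; 0; 0; - p; 0; r].
have hhV : h *m hV = 1%:M.
  rewrite mx4_1 mx4M; mx4_by ltac:(first [ring | rewrite -[in RHS]rtpq; ring]).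
have hS : h \in Sp4.
  apply/Sp4P; rewrite J_mx4 mx4T !mx4M.
  mx4_by ltac:(first [ring | rewrite -[in RHS]rtpq; ring]).
have hu := Sp4_unit hS.
have hVE : invmx h = hV by rewrite -[LHS]mulmx1 -hhV mulKmx.
exists (h *m g); first exact: Sp4M.
apply/subvP => _ /memv_imgP[X Xs ->]; rewrite conjugationM // conjugationE hVE.
have [c] := su X Xs; have [a11 [a12 [a [b11 [b12 [b [d EX]]]]]]] := gP X Xs.
rewrite /= EX rho_par => /rowP uX.
have := uX (inord 1); have := uX (inord 0).
rewrite !mxE !big_ord_recl !big_ord0 !mxE !inordK //= !addr0.
have -> : u 0 ord0 = p by congr (u _ _); apply: val_inj; rewrite /= inordK.
have -> : u 0 (lift ord0 ord0) = q by congr (u _ _); apply: val_inj; rewrite /= inordK.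
rewrite -/p -/q => eq_p eq_q; rewrite !mx4M; apply/mem_borelP.
exists a11, ((r * a + t * d) * q - (r * b - t * a) * p), ((r * b - t * a) * r - (r * a + t * d) * t).
exists (a12 * q - b12 * p), (b12 * r - a12 * t), b11; congr mx4.
do 12?[apply: (f_equal2 cons); first by ring].
apply: (f_equal2 cons); first by ring.
apply: (f_equal2 cons); last by do 16?[apply: (f_equal2 cons); first by ring].
(* Row 4, column 2: the entry that vanishes because (p, q) is an eigenvector of the 2x2 block. *)
transitivity ((p * a + q * d) * q - (p * b + q * - a) * p); first by ring.
by rewrite eq_p eq_q; ring.
Qed.

End Triangular.

(** * Codimension-one subalgebras of the Borel subalgebra *)

Section Hyperplanes.
Variable F : fieldType.
Implicit Types (X Y g : 'M[F]_4) (U V : {vspace 'M[F]_4}) (l : label F).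

Lemma dim_borel : \dim (borel F) = 6%N.
Proof.
pose B := [tuple T 1 0; T 0 1; X_a F; X_b F; X_ab F; X_a2b F].
have BE a b x y z w : bor a b x y z w = a *: T 1 0 + (b *: T 0 1 +
    (x *: X_a F + (y *: X_b F + (z *: X_ab F + w *: X_a2b F)))).
  rewrite bor_basis -!addrA [RHS]addrA; congr (_ + _).
  by rewrite !T_bor !borZ borD; congr bor; ring.
have -> : borel F = <<B>>%VS by rewrite /borel /t /n -span_cat.
suff /eqP : free B by rewrite -/(free B).
apply/freeP => k; rewrite !big_ord_recl big_ord0 /= addr0 -BE.
have -> : 0 = bor 0 0 0 0 0 0 :> 'M[F]_4 by rewrite BE !scale0r !addr0.
case/bor_inj => k0 k1 [k2 k3 k4 k5] i.
case: i => [[|[|[|[|[|[|//]]]]]] ?];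
  [rewrite -[RHS]k0|rewrite -[RHS]k1|rewrite -[RHS]k2|rewrite -[RHS]k3
   |rewrite -[RHS]k4|rewrite -[RHS]k5]; congr k; exact: val_inj.
Qed.

(* The linear equation cutting [algebra_of l] out of the Borel subalgebra. *)
Definition equation l (a b x y : F) : F :=
  match l with
  | L_t_np => y
  | L_t_b => x
  | L_T1 c => b - c * a
  | L_T10 => b
  | L_T01 => a
  | L_T11 => b - a
  | L_T1m1 => b + a
  end.

Lemma mem_line p q X : reflect (exists c x y z w, X = bor (c * p) (c * q) x y z w)
   (X \in <[T p q]> + n F)%VS.
Proof.
apply: (iffP (memv_lineD _ _ _)) => [[c [_ /mem_nP[x [y [z [w ->]]]] ->]]|[c [x [y [z [w ->]]]]]].
  by exists c, x, y, z, w; rewrite T_bor borZ borD !mulr0 !add0r !addr0.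
exists c, (bor 0 0 x y z w); first by apply/mem_nP; exists x, y, z, w.
by rewrite T_bor borZ borD !mulr0 !add0r !addr0.
Qed.

Lemma mem_span3 (u1 u2 u3 : 'M[F]_4) X :
  reflect (exists c1 c2 c3, X = c1 *: u1 + (c2 *: u2 + c3 *: u3))
          (X \in <<[:: u1; u2; u3]>>%VS).
Proof.
rewrite !span_cons span_nil addv0.
apply: (iffP (memv_lineD _ _ _)) => [[c1 [_ /memv_lineD[c2 [_ /vlineP[c3 ->] ->]] ->]]|[c1 [c2 [c3 ->]]]].
  by exists c1, c2, c3.
exists c1; eexists; last by [].
by apply/memv_lineD; exists c2; eexists; last by []; exact: memvZ (memv_line _).
Qed.

Lemma mem_algebra_of l X :
  reflect (exists a b x y z w, X = bor a b x y z w /\ equation l a b x y = 0)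
          (X \in algebra_of l).
Proof.
have tD v1 v2 v3 : reflect (exists a b c1 c2 c3, X = T a b + (c1 *: v1 + (c2 *: v2 + c3 *: v3)))
    (X \in t F + <<[:: v1; v2; v3]>>)%VS.
  apply: (iffP memv_addP) => [[_ /memtP[a [b ->]] [_ /mem_span3[c1 [c2 [c3 ->]]] ->]]|].
    by exists a, b, c1, c2, c3.
  move=> [a [b [c1 [c2 [c3 ->]]]]]; exists (T a b); first by apply/memtP; exists a, b.
  by eexists; last by []; apply/mem_span3; exists c1, c2, c3.
have line p q (e : F -> F -> F) : (forall c, e (c * p) (c * q) = 0) ->
    (forall a b, e a b = 0 -> exists c, a = c * p /\ b = c * q) ->
    reflect (exists a b (x y z w : F), X = bor a b x y z w /\ e a b = 0)
      (X \in <[T p q]> + n F)%VS.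
  move=> e1 e2; apply: (iffP (mem_line p q X)) => [[c [x [y [z [w ->]]]]]|].
    by exists (c * p), (c * q), x, y, z, w.
  move=> [a [b [x [y [z [w [-> /e2[c [-> ->]]]]]]]]].
  by exists c, x, y, z, w.
case: l => [||c||||] /=.
- apply: (iffP (tD _ _ _)) => [[a [b [x [z [w ->]]]]]|[a [b [x [_ [z [w [-> ->]]]]]]]].
    by exists a, b, x, 0, z, w; rewrite bor_basis scale0r addr0 !addrA.
  by exists a, b, x, z, w; rewrite bor_basis scale0r addr0 !addrA.
- apply: (iffP (tD _ _ _)) => [[a [b [y [z [w ->]]]]]|[a [b [_ [y [z [w [-> ->]]]]]]]].
    by exists a, b, 0, y, z, w; rewrite bor_basis scale0r add0r !addrA.
  by exists a, b, y, z, w; rewrite bor_basis scale0r add0r !addrA.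
- apply: (line _ _ (fun a b => b - c * a)) => [k|a b /subr0_eq ->]; first by ring.
  by exists a; split; ring.
- apply: (line _ _ (fun a b => b)) => [k|a b ->]; first by ring.
  by exists a; split; ring.
- apply: (line _ _ (fun a b => a)) => [k|a b ->]; first by ring.
  by exists b; split; ring.
- apply: (line _ _ (fun a b => b - a)) => [k|a b /subr0_eq ->]; first by ring.
  by exists a; split; ring.
- apply: (line _ _ (fun a b => b + a)) => [k|a b /addr0_eq <-]; first by ring.
  by exists (- b); split; ring.
Qed.

Lemma algebra_of_borel l : (algebra_of l <= borel F)%VS.
Proof.
apply/subvP => X /mem_algebra_of[a [b [x [y [z [w [-> _]]]]]]].
by apply/mem_borelP; exists a, b, x, y, z, w.
Qed.

(** The linear form [equation l] takes the value 1 at some [Y] of the six-dimensional Borel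
    subalgebra, which is therefore the direct sum of the line of [Y] and the algebra. *)
Lemma dim_algebra_of l : \dim (algebra_of l) = 5%N.
Proof.
suff [Y Yl YU] : exists2 Y, Y \notin algebra_of l & (borel F = <[Y]> + algebra_of l)%VS.
  have Y0 : Y != 0 by apply: contraNneq Yl => ->; exact: mem0v.
  have := dim_borel; rewrite YU dimv_disjoint_sum ?dim_vline ?Y0; first by case.
  apply/eqP; rewrite -subv0; apply/subvP => _ /memv_capP[/vlineP[c ->] cY].
  have [->|c0] := eqVneq c 0; first by rewrite scale0r mem0v.
  by case/negP: Yl; rewrite -[Y](scalerK c0) memvZ.
have [a [b [x [y e1]]]] : exists a b x y, equation l a b x y = 1.
  case: l => [||c||||] /=; [exists 0, 0, 0, 1|exists 0, 0, 1, 0|exists 0, 1, 0, 0|exists 0, 1, 0, 0|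
   exists 1, 0, 0, 0 |exists 0, 1, 0, 0|exists 0, 1, 0, 0]; ring.
exists (bor a b x y 0 0).
  apply/mem_algebra_of => -[a' [b' [x' [y' [z' [w' [/bor_inj[<- <- [<- <- _ _]]]]]]]]].
  by move=> e0; move/eqP: e1; rewrite e0 eq_sym oner_eq0.
apply/eqP; rewrite eqEsubv subv_add algebra_of_borel andbT; apply/andP; split.
  apply/subvP => X /mem_borelP[a' [b' [x' [y' [z' [w' ->]]]]]].
  set c := equation l a' b' x' y'; apply/memv_lineD; exists c.
  exists (bor (a' - c * a) (b' - c * b) (x' - c * x) (y' - c * y) z' w').
    apply/mem_algebra_of; do 6?eexists; split; first by [].
    transitivity (c * (1 - equation l a b x y)); last by rewrite e1 subrr mulr0.
    by rewrite /c; case: (l) => [||k||||] /=; ring.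
  by rewrite borZ borD; congr bor; ring.
by apply/mem_borelP; exists a, b, x, y, 0, 0.
Qed.

(** The coefficients are the values on the basis of a functional that vanishes on [U] but not on the
    whole Borel subalgebra; its kernel there equals [U] by dimension. *)
Lemma hyperplane_equation U : (U <= borel F)%VS -> \dim U = 5%N ->
  exists c1 c2 c3 c4 c5 c6,
    ~ [/\ c1 = 0, c2 = 0 & [/\ c3 = 0, c4 = 0, c5 = 0 & c6 = 0]] /\
    forall a b x y z w, bor a b x y z w \in U <->
      a * c1 + b * c2 + x * c3 + y * c4 + z * c5 + w * c6 = 0.
Proof.
move=> UB dU.
have [Y YB YU] : exists2 Y, Y \in borel F & Y \notin U.
  by apply/subvPn/negP => /dimvS; rewrite dU dim_borel.
have [phi Uphi phiY] := separating_functional YU.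
have UE : U = (borel F :&: lker phi)%VS.
  apply/eqP; rewrite eqEdim subv_cap UB Uphi dU -ltnS -dim_borel ltnNge.
  apply: contra phiY => dB.
  have /eqP BE : (borel F :&: lker phi)%VS == borel F by rewrite eqEdim capvSl.
  by move: YB; rewrite -BE memv_cap memv_ker => /andP[].
have phiE a b x y z w : phi (bor a b x y z w) =
    a * phi (T 1 0) + b * phi (T 0 1) + x * phi (X_a F) + y * phi (X_b F)
    + z * phi (X_ab F) + w * phi (X_a2b F).
  have -> : bor a b x y z w = a *: T 1 0 + b *: T 0 1 +
      (x *: X_a F + y *: X_b F + z *: X_ab F + w *: X_a2b F).
    rewrite bor_basis; congr (_ + _).
    by rewrite !T_bor !borZ borD; congr bor; ring.
  move: (X_a F) (X_b F) (X_ab F) (X_a2b F) (T 1 0) (T 0 1) => *.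
  by rewrite !linearD !linearZ /= !addrA.
exists (phi (T 1 0)), (phi (T 0 1)), (phi (X_a F)), (phi (X_b F)), (phi (X_ab F)), (phi (X_a2b F)).
split=> [[E1 E2 [E3 E4 E5 E6]]|a b x y z w].
  case/negP: phiY; have /mem_borelP[a [b [x [y [z [w ->]]]]]] := YB.
  by rewrite phiE E1 E2 E3 E4 E5 E6 !mulr0 !addr0.
rewrite -phiE UE memv_cap memv_ker; split=> [/andP[_ /eqP]//|->].
by rewrite eqxx andbT; apply/mem_borelP; exists a, b, x, y, z, w.
Qed.

End Hyperplanes.

(** * Normal forms of hyperplane subalgebras under root subgroups *)

Section Classification.
Variable F : numFieldType.
Implicit Types (X Y g : 'M[F]_4) (U V : {vspace 'M[F]_4}) (l : label F).
Local Notation Sp4 := (@Sp4 F).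

Lemma invmx_eq (g h : 'M[F]_4) : g *m h = 1%:M -> invmx g = h.
Proof. by move=> gh; have [gu _] := mulmx1_unit gh; rewrite -[LHS]mulmx1 -gh mulKmx. Qed.

(** This is exp(k X_alpha) = 1 + k X_alpha, as X_alpha squares to zero; [expXb] is the analogue for
    X_beta. *)
Definition expXa (k : F) : 'M[F]_4 := mx4 [:: 1; 0; 0; 0; 0; 1; 0; k; 0; 0; 1; 0; 0; 0; 0; 1].

Definition expXb (k : F) : 'M[F]_4 := mx4 [:: 1; k; 0; 0; 0; 1; 0; 0; 0; 0; 1; 0; 0; 0; - k; 1].

Lemma expXa_Sp4 k : expXa k \in Sp4.
Proof. by apply/Sp4P; rewrite J_mx4 mx4T !mx4M; mx4_ring. Qed.

Lemma expXb_Sp4 k : expXb k \in Sp4.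
Proof. by apply/Sp4P; rewrite J_mx4 mx4T !mx4M; mx4_ring. Qed.

(** The coordinate [x] moves by -k alpha(T_(a,b)). The last two coordinates stay unspecified, since
    no [equation] involves them. *)
Lemma conjugation_expXa k a b x y z w : exists z' w',
  conjugation (expXa k) (bor a b x y z w) = bor a b (x - (k * b) *+ 2) y z' w'.
Proof.
exists (z - k * y), w; rewrite conjugationE (@invmx_eq _ (expXa (- k))).
  by rewrite !mx4M; mx4_ring.
by rewrite mx4M mx4_1; mx4_ring.
Qed.

Lemma conjugation_expXb k a b x y z w : exists z' w',
  conjugation (expXb k) (bor a b x y z w) = bor a b x (y - k * (a - b)) z' w'.
Proof.
exists (z + k * x), (w + (k * z) *+ 2 + k * k * x).
rewrite conjugationE (@invmx_eq _ (expXb (- k))).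
  by rewrite !mx4M; mx4_ring.
by rewrite mx4M mx4_1; mx4_ring.
Qed.

Lemma sub_algebra_equiv U l g : g \in Sp4 -> \dim U = 5%N ->
  {in U, forall X, conjugation g X \in algebra_of l} ->
  Sp4_equivalent U (algebra_of l).
Proof.
move=> gS dU sub; exists g => //; apply/eqP; rewrite eqEdim.
rewrite dim_conjugation ?Sp4_unit // dU dim_algebra_of leqnn andbT.
by apply/subvP => _ /memv_imgP[X XU ->]; exact: sub.
Qed.

Lemma borel_subalgebra_classification U : (U <= borel F)%VS -> \dim U = 5%N ->
    {in U &, forall X Y, bracket X Y \in U} ->
  exists2 l, admissible l & Sp4_equivalent U (algebra_of l).
Proof.
move=> UB dU Ubr.
have [c1 [c2 [c3 [c4 [c5 [c6 [cN0 UE]]]]]]] := hyperplane_equation UB dU.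
have Uclosed a b x y z w a' b' x' y' z' w' :
    a * c1 + b * c2 + x * c3 + y * c4 + z * c5 + w * c6 = 0 ->
    a' * c1 + b' * c2 + x' * c3 + y' * c4 + z' * c5 + w' * c6 = 0 ->
    ((b * x' - b' * x) *+ 2) * c3 + ((a - b) * y' - (a' - b') * y) * c4
    + ((a + b) * z' - (a' + b') * z + (y * x' - y' * x)) * c5
    + ((a * w' - a' * w + (y * z' - y' * z)) *+ 2) * c6 = 0.
  move=> /UE XU /UE YU; have := Ubr _ _ XU YU.
  by rewrite bracket_bor => /UE; rewrite !mul0r !add0r.
have two0 : (2 : F) != 0 by rewrite pnatr_eq0.
(* X_beta and X_(alpha+beta), corrected by multiples of X_(alpha+2beta) to lie in [U], have bracket
   2 X_(alpha+2beta). *)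
have c60 : c6 = 0.
  apply/eqP; apply: contraT => c6N0.
  have := Uclosed 0 0 0 1 0 (- c4 / c6) 0 0 0 0 1 (- c5 / c6).
  rewrite !mul0r !add0r !mul1r !addr0 !divfK // !subrr => /(_ erefl erefl) H.
  by case/negP: c6N0; apply/eqP; apply: (mulfI two0); rewrite mulr0 -[RHS]H; ring.
(* Likewise X_beta and X_alpha, corrected by multiples of X_(alpha+beta), bracket to X_(alpha+beta)
   modulo X_(alpha+2beta). *)
have c50 : c5 = 0.
  apply/eqP; apply: contraT => c5N0.
  have := Uclosed 0 0 0 1 (- c4 / c5) 0 0 0 1 0 (- c3 / c5) 0.
  rewrite c60 !mul0r !mulr0 !add0r !mul1r !addr0 !divfK // !subrr => /(_ erefl erefl) H.
  by case/negP: c5N0; apply/eqP; rewrite -[RHS]H; ring.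
rewrite {}c50 {}c60 in cN0 UE Uclosed.
have inU X : X \in U -> exists a b x y z w, X = bor a b x y z w /\
    a * c1 + b * c2 + x * c3 + y * c4 = 0.
  move=> XU; have /mem_borelP[a [b [x [y [z [w E]]]]]] := subvP UB X XU.
  exists a, b, x, y, z, w; split=> //.
  by move: XU; rewrite E => /UE; rewrite !mulr0 !addr0.
(* T_(1,0), where alpha is 0 and beta is 1, is corrected by a multiple of X_alpha; its bracket with
   c4 X_alpha - c3 X_beta forces c3 c4 = 0. *)
have c3c4 : c3 = 0 \/ c4 = 0.
  have [->|c3N0] := eqVneq c3 0; [by left | right].
  have := Uclosed 0 0 c4 (- c3) 0 0 1 0 (- c1 / c3) 0 0 0.
  rewrite !mul0r !mulr0 !add0r !mul1r !addr0 !divfK // subrr => H.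
  apply: (mulfI c3N0); rewrite mulr0 -[RHS]H //; by ring.
have [c30|c3N0] := eqVneq c3 0; last first.
  have c40 : c4 = 0 by case: c3c4 => // /eqP; rewrite (negPf c3N0).
  have c10 : c1 = 0.
    have := Uclosed 1 0 (- c1 / c3) 0 0 0 0 1 (- c2 / c3) 0 0 0.
    rewrite !mul0r !mulr0 !add0r !mul1r !addr0 !divfK // !subrr => /(_ erefl erefl) H.
    by apply: (mulfI two0); rewrite mulr0 -[RHS]H c40; field.
  (* With this parameter the new [x] is x + (c2 / c3) b, which the equation of [U] makes zero. *)
  exists (L_t_b F) => //; apply: (@sub_algebra_equiv _ _ (expXa (- c2 / (c3 *+ 2)))) => //.
    exact: expXa_Sp4.
  move=> _ /inU[a [b [x [y [z [w [-> E]]]]]]].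
  have [z' [w' ->]] := conjugation_expXa (- c2 / (c3 *+ 2)) a b x y z w.
  apply/mem_algebra_of; do 6?eexists; split; first by [].
  move: E; rewrite c10 c40 !mulr0 add0r addr0 /= => E.
  apply: (mulfI c3N0); rewrite mulr0 -[RHS]E; field.
  by rewrite c3N0.
have [c40|c4N0] := eqVneq c4 0; last first.
  have c12 : c1 = - c2.
    have := Uclosed 1 0 0 (- c1 / c4) 0 0 0 1 0 (- c2 / c4) 0 0.
    rewrite c30 !mul0r !mulr0 !add0r !mul1r !addr0 !divfK // !subrr => /(_ erefl erefl) H.
    by apply/eqP; rewrite -subr_eq0 -oppr_eq0; apply/eqP; rewrite -[RHS]H; field.
  (* As c1 = - c2, the new [y] is y + (c1 / c4)(a - b), again zero by the equation of [U]. *)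
  exists (L_t_np F) => //; apply: (@sub_algebra_equiv _ _ (expXb (- c1 / c4))) => //.
    exact: expXb_Sp4.
  move=> _ /inU[a [b [x [y [z [w [-> E]]]]]]].
  have [z' [w' ->]] := conjugation_expXb (- c1 / c4) a b x y z w.
  apply/mem_algebra_of; do 6?eexists; split; first by [].
  move: E; rewrite c30 mulr0 addr0 /= => E.
  apply: (mulfI c4N0); rewrite mulr0 -[RHS]E c12; field.
  by rewrite c4N0.
(* Now [U] contains [n], and only the line of T remains to be named; no conjugation is required. *)
have by_id l : (forall a b x y, a * c1 + b * c2 = 0 -> equation l a b x y = 0) ->
    Sp4_equivalent U (algebra_of l).
  move=> sub; have S1 : 1%:M \in Sp4 by apply/Sp4P; rewrite mul1mx trmx1 mulmx1.
  apply: (sub_algebra_equiv S1 dU) => X XU.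
  rewrite conjugationE mul1mx invmx1 mulmx1.
  have [a [b [x [y [z [w [-> E]]]]]]] := inU X XU.
  apply/mem_algebra_of; exists a, b, x, y, z, w; split=> //; apply: sub.
  by move: E; rewrite c30 c40 !mulr0 !addr0.
have [c20|c2N0] := eqVneq c2 0.
  have c1N0 : c1 != 0 by apply/eqP => c10; apply: cN0.
  exists (L_T01 F) => //; apply: by_id => a b x y /eqP.
  by rewrite c20 mulr0 addr0 mulf_eq0 (negPf c1N0) orbF => /eqP.
set k := - c1 / c2.
have bk a b : a * c1 + b * c2 = 0 -> b = k * a.
  by move=> E; apply: (mulfI c2N0); rewrite -[LHS]subr0 -E /k; field.
have [k0|k0] := eqVneq k 0.
  by exists (L_T10 F) => //; apply: by_id => a b x y /bk; rewrite k0 mul0r.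
have [k1|k1] := eqVneq k 1.
  exists (L_T11 F) => //; apply: by_id => a b x y /bk ->.
  by rewrite k1 mul1r /= subrr.
have [kN1|kN1] := eqVneq k (- 1).
  exists (L_T1m1 F) => //; apply: by_id => a b x y /bk ->.
  by rewrite kN1 mulN1r /= addNr.
exists (L_T1 k); first by split; exact/eqP.
by apply: by_id => a b x y /bk -> /=; rewrite subrr.
Qed.

End Classification.

(** * Isomorphism invariants *)

Section Invariants.
Variable F : numFieldType.
Implicit Types (X Y Z W H g : 'M[F]_4) (U V : {vspace 'M[F]_4}) (l : label F).

Lemma algebra_of_sp4_subalgebra l : sp4_subalgebra (algebra_of l).
Proof.
split=> [_ /mem_algebra_of[a [b [x [y [z [w [-> _]]]]]]]|]; first exact: bor_sp4.
move=> ? ? /mem_algebra_of[a [b [x [y [z [w [-> e]]]]]]].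
move=> /mem_algebra_of[a' [b' [x' [y' [z' [w' [-> e']]]]]]].
rewrite bracket_bor; apply/mem_algebra_of; do 6?eexists; split; first by [].
by case: l e e' => [||c||||] /= e e'; rewrite ?e ?e' ?(mulr0, subrr, mul0rn, addr0).
Qed.

(** The chain t + n, n, n_p, 0 bounds the derived series; [zn] below is the abelian algebra n_p. *)
Lemma borel_solvable : lie_solvable (borel F).
Proof.
pose zn : {vspace 'M[F]_4} := <<[:: X_a F; X_ab F; X_a2b F]>>%VS.
have znP x z w : bor 0 0 x 0 z w \in zn.
  apply/mem_span3; exists x, z, w.
  by rewrite bor_basis T_bor bor0 add0r scale0r addr0 addrA.
have memzn X : X \in zn -> exists x z w, X = bor 0 0 x 0 z w.
  move=> /mem_span3[x [z [w ->]]]; exists x, z, w.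
  by rewrite bor_basis T_bor bor0 add0r scale0r addr0 addrA.
have D1 : (derived (borel F) <= n F)%VS.
  apply/derived_subP => ? ? /mem_borelP[a [b [x [y [z [w ->]]]]]].
  move=> /mem_borelP[a' [b' [x' [y' [z' [w' ->]]]]]].
  by apply/mem_nP; rewrite bracket_bor; do 4?eexists.
have D2 : (derived (n F) <= zn)%VS.
  apply/derived_subP => ? ? /mem_nP[x [y [z [w ->]]]] /mem_nP[x' [y' [z' [w' ->]]]].
  by rewrite bracket_bor subr0 !mul0r subr0; exact: znP.
have D3 : (derived zn <= 0)%VS.
  apply/derived_subP => ? ? /memzn[x [z [w ->]]] /memzn[x' [z' [w' ->]]].
  by rewrite bracket_bor !(addr0, mul0r, subrr, mul0rn) bor0 mem0v.
exists 3%N; apply/eqP; rewrite -subv0 /=.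
apply: subv_trans D3; apply: derived_mono; apply: subv_trans D2; exact: derived_mono.
Qed.

(** Nilpotency of ad X on [U] itself, so that it depends only on the abstract Lie algebra. *)
Definition adnil U X := X \in U /\ exists k, {in U, forall Y, iter k (bracket X) Y = 0}.

(** X_(alpha+2beta) and X_(alpha+beta) lie in every algebra. On the first ad X has eigenvalue 2a, so
    a = 0; modulo the first, it then has eigenvalue b on the second. *)
Lemma adnil_algebra_of l X : adnil (algebra_of l) X <->
  exists x y z w, X = bor 0 0 x y z w /\ equation l 0 0 x y = 0.
Proof.
have in_n' z w : bor 0 0 0 0 z w \in algebra_of l.
  apply/mem_algebra_of; do 6?eexists; split; first by [].
  by case: l => [||c||||] /=; rewrite ?mulr0 ?subr0 ?addr0.
split=> [[/mem_algebra_of[a [b [x [y [z [w [-> e]]]]]]] [k Xk]]|].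
  have a0 : a = 0.
    have := Xk _ (in_n' 0 1); have -> : iter k (bracket (bor a b x y z w)) (bor 0 0 0 0 0 1)
        = bor 0 0 0 0 0 ((a *+ 2) ^+ k).
      elim: k {Xk} => [|k /= ->]; first by rewrite expr0.
      by rewrite bracket_bor; congr bor; rewrite ?exprS; ring.
    rewrite -bor0 => /bor_inj[_ _ [_ _ _ /eqP]].
    by rewrite expf_eq0 mulrn_eq0 => /andP[_ /eqP].
  have b0 : b = 0.
    have := Xk _ (in_n' 1 0); have [w' ->] : exists w', iter k (bracket (bor a b x y z w))
        (bor 0 0 0 0 1 0) = bor 0 0 0 0 (b ^+ k) w'.
      elim: k {Xk} => [|k /= [w' ->]]; first by exists 0; rewrite expr0.
      exists ((a * w' + y * b ^+ k) *+ 2).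
      by rewrite bracket_bor a0; congr bor; rewrite ?exprS; ring.
    rewrite -bor0 => /bor_inj[_ _ [_ _ /eqP]].
    by rewrite expf_eq0 => /andP[_ /eqP].
  by move: e; rewrite a0 b0 => e; exists x, y, z, w.
move=> [x [y [z [w [-> e]]]]]; split.
  by apply/mem_algebra_of; exists 0, 0, x, y, z, w.
(* Each bracket with an element of [n] raises the root height, and the highest root has height
   three. *)
exists 4%N => _ /mem_algebra_of[a' [b' [x' [y' [z' [w' [-> _]]]]]]].
by rewrite /= !bracket_bor -bor0; congr bor; ring.
Qed.

Lemma lie_isomorphic_sym U V : sp4_subalgebra U ->
  lie_isomorphic U V -> lie_isomorphic V U.
Proof.
move=> [_ Ubr] [f [fU fI fbr]].
(* [f] need not be injective outside [U], hence the projection. *)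
pose h := (f \o projv U)%VF; pose g := (projv U \o h^-1)%VF.
have gU Y : g Y \in U by rewrite comp_lfunE memv_proj.
have fg Y : Y \in V -> f (g Y) = Y.
  move=> YV; have Yh : Y \in limg h.
    by move: YV; rewrite -fU limg_comp limg_proj.
  by have := limg_lfunVK Yh; rewrite /g /h !comp_lfunE.
have gf X : X \in U -> g (f X) = X.
  by move=> XU; apply: fI => //; apply: fg; rewrite -fU memv_img.
exists g; split.
- apply/eqP; rewrite eqEsubv; apply/andP; split; apply/subvP => X.
    by case/memv_imgP => Y _ ->.
  by move=> XU; rewrite -(gf X XU) memv_img // -fU memv_img.
- by move=> X Y XV YV gXY; rewrite -(fg X XV) gXY fg.
- move=> X Y XV YV; rewrite -{1}(fg X XV) -{1}(fg Y YV) -fbr //.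
  by rewrite gf // Ubr.
Qed.

Section Transport.
Variables (U V : {vspace 'M[F]_4}) (f : 'End('M[F]_4)).
Hypothesis U_br : {in U &, forall X Y, bracket X Y \in U}.
Hypothesis f_img : (f @: U)%VS = V.
Hypothesis f_br : {in U &, forall X Y, f (bracket X Y) = bracket (f X) (f Y)}.

Lemma adnil_img X : adnil U X -> adnil V (f X).
Proof.
move=> [XU [k Xk]]; split; first by rewrite -f_img memv_img.
exists k => Y'; rewrite -f_img => /memv_imgP[Y YU ->].
suff [_ <-] : iter k (bracket X) Y \in U /\
    f (iter k (bracket X) Y) = iter k (bracket (f X)) (f Y).
  by rewrite Xk // linear0.
by elim: k {Xk} => //= k [kU <-]; rewrite U_br // f_br.
Qed.

End Transport.

(** Formulated by brackets and ad-nilpotency alone, hence invariant under isomorphism; [mu] and [nu]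
    are meant to read off alpha+2beta and alpha+beta on the toral part of [H]. *)
Definition ad_weights U mu nu := exists H X Y W,
  [/\ H \in U, adnil U X, adnil U Y & adnil U W] /\
  [/\ bracket X (bracket Y W) != 0,
      bracket H (bracket X (bracket Y W)) = mu *: bracket X (bracket Y W)
    & bracket H (bracket Y W) = nu *: bracket Y W].

Definition adnil_nonabelian U := exists X Y, [/\ adnil U X, adnil U Y & bracket X Y != 0].

Lemma ad_weights_img U V mu nu : sp4_subalgebra U ->
  lie_isomorphic U V -> ad_weights U mu nu -> ad_weights V mu nu.
Proof.
move=> [_ Ubr] [f [fU fI fbr]] [H [X [Y [W [[HU Xn Yn Wn] [Z0 HZ HV]]]]]].
have [XU _] := Xn; have [YU _] := Yn; have [WU _] := Wn.
have VU := Ubr _ _ YU WU; have ZU := Ubr _ _ XU VU.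
exists (f H), (f X), (f Y), (f W); split.
  by split; [rewrite -fU memv_img | exact: (adnil_img Ubr fU fbr) ..].
rewrite -!fbr // HZ HV !linearZ; split=> //.
by apply: contraNneq Z0 => fZ; apply/eqP/fI; rewrite ?mem0v // linear0.
Qed.

Lemma adnil_nonabelian_img U V : sp4_subalgebra U ->
  lie_isomorphic U V -> adnil_nonabelian U -> adnil_nonabelian V.
Proof.
move=> [_ Ubr] [f [fU fI fbr]] [X [Y [Xn Yn XY]]].
have [XU _] := Xn; have [YU _] := Yn; have ZU := Ubr _ _ XU YU.
exists (f X), (f Y); split; [exact: (adnil_img Ubr fU fbr) .. |].
rewrite -fbr //; apply: contraNneq XY => fZ; apply/eqP/fI; rewrite ?mem0v //.
by rewrite linear0.
Qed.

Definition direction l : option (F * F) :=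
  match l with
  | L_t_np | L_t_b => None
  | L_T1 c => Some (1, c)
  | L_T10 => Some (1, 0)
  | L_T01 => Some (0, 1)
  | L_T11 => Some (1, 1)
  | L_T1m1 => Some (1, -1)
  end.

Lemma ad_weights_direction l p q : direction l = Some (p, q) ->
  ad_weights (algebra_of l) (p *+ 2) (p + q).
Proof.
(* H = T_(p,q), X = Y = X_beta and W = X_alpha, for which [X, [Y, W]] = 2 X_(alpha+2beta). *)
move=> dl; exists (bor p q 0 0 0 0), (bor 0 0 0 1 0 0), (bor 0 0 0 1 0 0), (bor 0 0 1 0 0 0).
have eq0 x y : equation l 0 0 x y = 0.
  by case: l dl => [||c||||] //= _; rewrite ?mulr0 ?addr0 ?subr0.
split; [split|].
- apply/mem_algebra_of; do 6?eexists; split; first by [].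
  by case: l dl {eq0} => [||c||||] //= [] *; subst; ring.
- by apply/adnil_algebra_of; do 4?eexists.
- by apply/adnil_algebra_of; do 4?eexists.
- by apply/adnil_algebra_of; do 4?eexists.
rewrite !bracket_bor !borZ; split; try by congr bor; ring.
rewrite -bor0; apply/eqP => /bor_inj[_ _ [_ _ _ /eqP]].
by rewrite !(mul0r, mulr0, oppr0, addr0, add0r, mulr1, mul1r) mulrn_eq0 oner_eq0.
Qed.

(** The triple bracket is 2 y1 v X_(alpha+2beta), where v is the X_(alpha+beta) coordinate of
    [Y, W]. Without X_beta the factor y1 vanishes, without X_alpha the factor v does; otherwise
    comparing coordinates gives both eigenvalues. *)
Lemma ad_weights_algebra_of l mu nu : ad_weights (algebra_of l) mu nu ->
  direction l != None /\ exists a b, [/\ equation l a b 0 0 = 0, mu = a *+ 2 & nu = a + b].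
Proof.
move=> [_ [_ [_ [_ [[/mem_algebra_of[a [b [x [y [z [w [-> e]]]]]]]
  /adnil_algebra_of[x1 [y1 [z1 [w1 [-> e1]]]]]
  /adnil_algebra_of[x2 [y2 [z2 [w2 [-> e2]]]]]
  /adnil_algebra_of[x3 [y3 [z3 [w3 [-> e3]]]]]]]]]]].
rewrite !bracket_bor !borZ !(mul0r, mulr0, oppr0, mul0rn, addr0, add0r).
set v := y2 * x3 - y3 * x2 => -[].
have [-> /eqP|v0] := eqVneq v 0; first by rewrite !mulr0 mul0rn bor0.
have [-> /eqP|y10] := eqVneq y1 0; first by rewrite !mul0r mul0rn bor0.
move=> _ /bor_inj[_ _ [_ _ _ eZ]] /bor_inj[_ _ [_ _ eV _]].
have m0 : (y1 * v) *+ 2 != 0 by rewrite mulrn_eq0 mulf_neq0.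
split; last first.
  exists a, b; split.
  - by case: l e e1 e2 e3 => [||c||||].
  - by apply: (mulIf m0); rewrite -eZ; ring.
  - by apply: (mulIf v0); rewrite -eV.
case: l {e} e1 e2 e3 => //= e1 e2 e3; first by rewrite e1 eqxx in y10.
by rewrite /v e2 e3 !mulr0 subrr eqxx in v0.
Qed.

Lemma algebra_of_not_isomorphic l l' : admissible l -> admissible l' -> l <> l' ->
  ~ lie_isomorphic (algebra_of l) (algebra_of l').
Proof.
have sA := algebra_of_sp4_subalgebra.
(* The eigenvalues 2p and p + q determine (p, q), so the toral direction of [k] must satisfy the
   equation of [k']. *)
have lines p q k k' : direction k = Some (p, q) ->
    lie_isomorphic (algebra_of k) (algebra_of k') ->
    direction k' != None /\ equation k' p q 0 0 = 0.
  move=> /ad_weights_direction wk /(ad_weights_img (sA k))/(_ wk)/ad_weights_algebra_of.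
  move=> [dk' [a [b [e pa ab]]]]; split=> //.
  have pE : p = a by apply/(@mulIr F 2); rewrite ?unitfE ?pnatr_eq0 // !mulr_natr.
  by rewrite pE; move: ab; rewrite pE => /addrI ->.
have nonab : adnil_nonabelian (algebra_of (L_t_b F)).
  exists (bor 0 0 0 1 0 0), (bor 0 0 0 0 1 0); split.
  - by apply/adnil_algebra_of; do 4?eexists.
  - by apply/adnil_algebra_of; do 4?eexists.
  rewrite bracket_bor -bor0; apply/eqP => /bor_inj[_ _ [_ _ _ /eqP]].
  by rewrite !(mul0r, mulr0, oppr0, addr0, add0r, mulr1, mul1r) mulrn_eq0 oner_eq0.
have ab : ~ adnil_nonabelian (algebra_of (L_t_np F)).
  move=> [_ [_ [/adnil_algebra_of[x1 [y1 [z1 [w1 [-> e1]]]]]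
     /adnil_algebra_of[x2 [y2 [z2 [w2 [-> e2]]]]]]]].
  rewrite bracket_bor (e1 : y1 = 0) (e2 : y2 = 0).
  by rewrite !(mul0r, mulr0, oppr0, mul0rn, addr0, add0r) bor0 eqxx.
case dl : (direction l) => [[p q]|]; last first.
  case dl' : (direction l') => [[p q]|].
    by move=> _ _ _ /(lie_isomorphic_sym (sA l))/(lines _ _ _ _ dl')[]; rewrite dl.
  case: l dl => [||c||||] // _; case: l' dl' => [||c||||] // _ _ _ _.
    by move/(lie_isomorphic_sym (sA _))/(adnil_nonabelian_img (sA _))/(_ nonab).
  by move/(adnil_nonabelian_img (sA _))/(_ nonab).
move=> al al' ll' /(lines _ _ _ _ dl)[dl' /eqP].
have one2 : 1 + 1 != 0 :> F by rewrite -(natrD _ 1 1) pnatr_eq0.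
(* Evaluating the equation of [l'] at the direction of [l] leaves coincidences excluded by
   admissibility, by [ll'], or by 2 being nonzero. *)
case: l dl al ll' => [||c||||] //= [<- <-] al ll';
  case: l' dl' al' ll' => [||c'||||] //= _ al' ll';
rewrite ?mulr1 ?mulr0 ?subr0 ?addr0 ?subrr ?oppr0 ?add0r ?sub0r
  ?subr_eq0 ?addr_eq0 ?oppr_eq0 ?oner_eq0 //.
- by move=> /eqP cc'; apply: ll'; rewrite cc'.
- by case: al => c0 _ _ /eqP.
- by case: al => _ c1 _ /eqP.
- by case: al => _ _ cN1 /eqP.
- by case: al' => c0 _ _ /eqP.
- by case: al' => _ c1 _; rewrite eq_sym => /eqP.
- by rewrite -addr_eq0 (negPf one2).
- by case: al' => _ _ cN1; rewrite eq_sym => /eqP.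
- by rewrite eq_sym -addr_eq0 (negPf one2).
Qed.

End Invariants.

(** * The classification over a closed field, and its complex instance *)

Theorem five_dimensional_solvable_subalgebras (F : numClosedFieldType) :
  [/\ forall l : label F, admissible l ->
        [/\ sp4_subalgebra (algebra_of l), lie_solvable (algebra_of l)
          & \dim (algebra_of l) = 5%N],
      forall s : {vspace 'M[F]_4},
        sp4_subalgebra s -> lie_solvable s -> \dim s = 5%N ->
        exists2 l : label F, admissible l & Sp4_equivalent s (algebra_of l)
    & forall l l' : label F, admissible l -> admissible l' -> l <> l' ->
        ~ lie_isomorphic (algebra_of l) (algebra_of l')].
Proof.
split=> [l _|s s_sub s_sol s_dim|]; last exact: algebra_of_not_isomorphic.
  split; [exact: algebra_of_sp4_subalgebra | | exact: dim_algebra_of].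
  exact: lie_solvableS (algebra_of_borel l) (borel_solvable _).
have [g gS sB] := solvable_conj_borel s_sub s_sol.
have gu := Sp4_unit gS; have [_ s_br] := s_sub.
have [||l al [h hS hE]] := borel_subalgebra_classification sB.
- by rewrite dim_conjugation.
- move=> _ _ /memv_imgP[X Xs ->] /memv_imgP[Y Ys ->].
  by rewrite -conjugation_bracket // memv_img // s_br.
exists l => //; exists (h *m g); first exact: Sp4M.
rewrite -hE -limg_comp; apply/eq_in_limg => X _.
by rewrite comp_lfunE conjugationM // Sp4_unit.
Qed.

Local Open Scope complex_scope.

Theorem theorem9p1 (R : realType) :
  [/\ forall l : label R[i], admissible l ->
        [/\ sp4_subalgebra (algebra_of l), lie_solvable (algebra_of l)
          & \dim (algebra_of l) = 5%N],
      forall s : {vspace 'M[R[i]]_4},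
        sp4_subalgebra s -> lie_solvable s -> \dim s = 5%N ->
        exists2 l : label R[i], admissible l & Sp4_equivalent s (algebra_of l)
    & forall l l' : label R[i], admissible l -> admissible l' -> l <> l' ->
        ~ lie_isomorphic (algebra_of l) (algebra_of l')].
Proof. exact: (five_dimensional_solvable_subalgebras R[i]). Qed.
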